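(* The categories $\mathbf{LSS}^s_0$, $\mathbf{ZLatD}^{op}$ and $\mathbf{slSpecD}^s$ are equivalent.
   Context: Foundations: ZFC with a universe; objects of the categories are structures on sets of that universe. The category $\mathbf{LSS}^s_0$. A locally small space is a pair $(X,\mathcal{L}_X)$ with $X$ a set and $\mathcal{L}_X\subseteq\mathcal{P}(X)$ such that $\emptyset\in\mathcal{L}_X$, $A,B\in\mathcal{L}_X$ implies $A\cap B,A\cup B\in\mathcal{L}_X$, and $\bigcup\mathcal{L}_X=X$. It is $T_0$ (Kolmogorov) if whenever $x,y\in X$ satisfy ($x\in A\iff y\in A$) for all $A\in\mathcal{L}_X$, then $x=y$. A mapping $f:X\to Y$ between locally small spaces is bounded if for each $A\in\mathcal{L}_X$ there is $B\in\mathcal{L}_Y$ with $A\subseteq f^{-1}(B)$, and strongly continuous if $f^{-1}(B)\in\mathcal{L}_X$ for all $B\in\mathcal{L}_Y$. $\mathbf{LSS}^s_0$ has the $T_0$ locally small spaces as objects and the bounded strongly continuous mappings as morphisms. The category $\mathbf{slSpecD}^s$. For a topological space $X$, $CO(X)$ denotes the family of compact (not necessarily Hausdorff) open subsets. A spectral space is a $T_0$, sober topological space $X$ such that $X\in CO(X)$, $CO(X)$ is a basis of the topology, and $CO(X)$ is closed under binary intersections; sober means that every open $W\neq X$ either is of the form $W=V_1\cap V_2$ with $V_1,V_2$ open and $W\ne V_1$, $W\neq V_2$, or equals $X\setminus\overline{\{x\}}$ for some $x\in X$. A topological space $X$ is strongly locally spectral if it is covered by its open subsets whose subspace topology is spectral,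 and $CO(X)$ is closed under binary intersections. A subset $X_d$ of a strongly locally spectral space $X$ is decent if for all $A,B\in CO(X)$, $A\neq B$ implies $A\cap X_d\neq B\cap X_d$. A mapping $g:X\to Y$ between strongly locally spectral spaces is strongly spectral if it is bounded (for each $A\in CO(X)$ there is $B\in CO(Y)$ with $g(A)\subseteq B$) and strongly continuous ($g^{-1}(B)\in CO(X)$ for all $B\in CO(Y)$). Objects of $\mathbf{slSpecD}^s$ are pairs $((X,\tau_X),X_d)$ with $(X,\tau_X)$ a strongly locally spectral space and $X_d$ a distinguished decent subset of $X$; morphisms from $((X,\tau_X),X_d)$ to $((Y,\tau_Y),Y_d)$ are strongly spectral mappings $g:X\to Y$ with $g(X_d)\subseteq Y_d$. The category $\mathbf{ZLatD}$. For a distributive lattice $L$ with zero, $\mathcal{PF}(L)$ is the set of all (nonempty, proper) prime filters of $L$. Objects of $\mathbf{ZLatD}$ are pairs $(L,\mathbf{D}_L)$ with $L$ a distributive lattice with zero and $\mathbf{D}_L\subseteq\mathcal{PF}(L)$ a decent set of prime filters, i.e. for all $a,b\in L$, $a\neq b$ implies $\{F\in\mathbf{D}_L\mid a\in F\}\neq\{F\in\mathbf{D}_L\mid b\in F\}$. Morphisms from $(L,\mathbf{D}_L)$ to $(M,\mathbf{D}_M)$ are lattice homomorphisms $h:L\to M$ preserving zero, satisfying the condition of domination (for each $a\in M$ there is $b\in L$ with $a\vee h(b)=h(b)$), and satisfying $h^{\bullet}(\mathbf{D}_M)\subseteq\mathbf{D}_L$, where $h^{\bullet}(G)=\{a\in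 L\mid h(a)\in G\}$ for $G\in\mathcal{PF}(M)$. In all three categories composition is composition of mappings; $^{op}$ denotes the opposite category. *)

(* Defs.v *)
From HB Require Import structures.
From mathcomp Require Import all_boot all_order.
From mathcomp Require Import all_classical topology.

Set Implicit Arguments.
Unset Strict Implicit.
Unset Printing Implicit Defensive.

Import Order.Theory.

Local Open Scope classical_set_scope.

Record category := Category {
  obj :> Type;
  hom : obj -> obj -> Type;
  idm : forall X, hom X X;
  compm : forall X Y Z, hom Y Z -> hom X Y -> hom X Z;
  compm1 : forall X Y (f : hom X Y), compm f (idm X) = f;
  comp1m : forall X Y (f : hom X Y), compm (idm Y) f = f;
  compmA : forall X Y Z W (h : hom Z W) (g : hom Y Z) (f : hom X Y),
    compm h (compm g f) = compm (compm h g) f }.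

Arguments hom {c} X Y.
Arguments idm {c} X.
Arguments compm {c X Y Z} g f : rename.

Definition op (C : category) : category :=
  @Category C (fun X Y => hom Y X) (fun X => idm X)
    (fun X Y Z g f => compm f g)
    (fun X Y f => comp1m f) (fun X Y f => compm1 f)
    (fun X Y Z W h g f => esym (compmA f g h)).

Record functor (C D : category) := Functor {
  fobj :> C -> D;
  fmap : forall X Y, hom X Y -> hom (fobj X) (fobj Y);
  fmap_id : forall X, fmap (idm X) = idm (fobj X);
  fmap_comp : forall X Y Z (g : hom Y Z) (f : hom X Y),
    fmap (compm g f) = compm (fmap g) (fmap f) }.

Arguments fmap {C D} F {X Y} f : rename.

Definition id_functor (C : category) : functor C C :=
  @Functor C C id (fun X Y f => f) (fun X => erefl) (fun X Y Z g f => erefl).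

Lemma comp_functor_id (C D E : category) (G : functor D E) (F : functor C D) X :
  fmap G (fmap F (idm X)) = idm (G (F X)).
Proof. by rewrite !fmap_id. Qed.

Lemma comp_functor_comp (C D E : category) (G : functor D E) (F : functor C D)
    (X Y Z : C) (g : hom Y Z) (f : hom X Y) :
  fmap G (fmap F (compm g f)) =
  compm (fmap G (fmap F g)) (fmap G (fmap F f)).
Proof. by rewrite !fmap_comp. Qed.

Definition comp_functor (C D E : category) (G : functor D E) (F : functor C D) :
    functor C E :=
  @Functor C E (fun X => G (F X)) (fun X Y f => fmap G (fmap F f))
    (comp_functor_id G F) (comp_functor_comp G F).

Definition iso (C : category) (X Y : C) (f : hom X Y) : Prop :=
  exists g : hom Y X, compm g f = idm X /\ compm f g = idm Y.

Definition naturally_isomorphic (C D : category) (F G : functor C D) : Prop :=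
  exists eta : forall X, hom (F X) (G X),
    (forall X Y (f : hom X Y),
      compm (fmap G f) (eta X) = compm (eta Y) (fmap F f)) /\
    (forall X, iso (eta X)).

Definition equivalent_categories (C D : category) : Prop :=
  exists (F : functor C D) (G : functor D C),
    naturally_isomorphic (comp_functor G F) (id_functor C) /\
    naturally_isomorphic (comp_functor F G) (id_functor D).

Record lss0 := LSS0 {
  lss0_car :> Type;
  smops : set (set lss0_car);
  smops0 : smops set0;
  smopsI : setI_closed smops;
  smopsU : setU_closed smops;
  smopsT : \bigcup_(A in smops) A = [set: lss0_car];
  lss0_T0 : forall x y : lss0_car,
    (forall A, smops A -> (A x <-> A y)) -> x = y }.

Arguments smops : clear implicits.

Record lss0_hom (X Y : lss0) := LSS0Hom {
  lss0_fun :> X -> Y;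
  lss0_bounded : forall A, smops X A ->
    exists2 B, smops Y B & A `<=` lss0_fun @^-1` B;
  lss0_scontinuous : forall B, smops Y B -> smops X (lss0_fun @^-1` B) }.

Lemma lss0_hom_eq (X Y : lss0) (f g : lss0_hom X Y) : f =1 g -> f = g.
Proof.
case: f g => [f fb fc] [g gb gc] /= /funext fg.
by subst g; rewrite (Prop_irrelevance fb gb) (Prop_irrelevance fc gc).
Qed.

Lemma lss0_id_bounded (X : lss0) A :
  smops X A -> exists2 B, smops X B & A `<=` id @^-1` B.
Proof. by move=> LA; exists A. Qed.

Definition lss0_id (X : lss0) : lss0_hom X X :=
  @LSS0Hom X X id (@lss0_id_bounded X) (fun B LB => LB).

Lemma lss0_comp_bounded (X Y Z : lss0) (g : lss0_hom Y Z) (f : lss0_hom X Y) A :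
  smops X A -> exists2 C, smops Z C & A `<=` (g \o f) @^-1` C.
Proof.
move=> /(lss0_bounded f)[B LB AB]; have [C LC BC] := lss0_bounded g LB.
by exists C => // x /AB; apply: BC.
Qed.

Definition lss0_comp (X Y Z : lss0) (g : lss0_hom Y Z) (f : lss0_hom X Y) :
    lss0_hom X Z :=
  @LSS0Hom X Z (g \o f) (lss0_comp_bounded g f)
    (fun C LC => lss0_scontinuous f (lss0_scontinuous g LC)).

Definition LSSs0 : category.
Proof.
by apply: (@Category lss0 lss0_hom lss0_id lss0_comp) => *; apply: lss0_hom_eq.
Defined.

Definition CO (X : topologicalType) : set (set X) :=
  [set A | compact A /\ open A].

Definition sober (X : topologicalType) : Prop :=
  forall W : set X, open W -> W <> setT ->
    (exists V1 V2 : set X,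
       [/\ open V1, open V2, W = V1 `&` V2, W <> V1 & W <> V2]) \/
    (exists x : X, W = ~` closure [set x]).

Definition spectral (X : topologicalType) : Prop :=
  [/\ kolmogorov_space X, sober X, CO [set: X], basis (@CO X) &
      setI_closed (@CO X)].

(* The library topology on [set_type U] is the one induced from [X]. *)
Definition strongly_locally_spectral (X : topologicalType) : Prop :=
  \bigcup_(U in [set U : set X | open U /\ spectral (set_type U)]) U = [set: X]
  /\ setI_closed (@CO X).

Definition decent_subset (X : topologicalType) (Xd : set X) : Prop :=
  forall A B : set X, CO A -> CO B -> A <> B -> A `&` Xd <> B `&` Xd.

Definition strongly_spectral (X Y : topologicalType) (g : X -> Y) : Prop :=
  (forall A, CO A -> exists2 B, CO B & g @` A `<=` B) /\
  (forall B, CO B -> CO (g @^-1` B)).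

Record slspecd := SLSpecD {
  slspecd_space :> topologicalType;
  distinguished : set slspecd_space;
  slspecd_sls : strongly_locally_spectral slspecd_space;
  slspecd_decent : decent_subset distinguished }.

Arguments distinguished : clear implicits.

Record slspecd_hom (X Y : slspecd) := SLSpecDHom {
  slspecd_fun :> X -> Y;
  slspecd_spectral : strongly_spectral slspecd_fun;
  slspecd_dist :
    slspecd_fun @` distinguished X `<=` distinguished Y }.

Lemma slspecd_hom_eq (X Y : slspecd) (f g : slspecd_hom X Y) :
  f =1 g -> f = g.
Proof.
case: f g => [f fs fd] [g gs gd] /= /funext fg.
by subst g; rewrite (Prop_irrelevance fs gs) (Prop_irrelevance fd gd).
Qed.

Lemma strongly_spectral_id (X : topologicalType) : strongly_spectral (@id X).
Proof. by split=> // A COA; exists A => // _ [x Ax <-]. Qed.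

Lemma strongly_spectral_comp (X Y Z : topologicalType) (g : Y -> Z) (f : X -> Y) :
  strongly_spectral g -> strongly_spectral f -> strongly_spectral (g \o f).
Proof.
move=> [gb gc] [fb fc]; split=> [A /fb[B /gb[C COC BC] AB]|C /gc/fc //].
by exists C => // _ [x Ax <-]; apply: BC; exists (f x) => //; apply: AB; exists x.
Qed.

Lemma slspecd_id_dist (X : slspecd) :
  id @` distinguished X `<=` distinguished X.
Proof. by move=> _ [x Xx <-]. Qed.

Lemma slspecd_comp_dist (X Y Z : slspecd) (g : slspecd_hom Y Z)
  (f : slspecd_hom X Y) : (g \o f) @` distinguished X `<=` distinguished Z.
Proof.
move=> _ [x Xx <-]; apply: (slspecd_dist (s := g)); exists (f x) => //.
by apply: (slspecd_dist (s := f)); exists x.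
Qed.

Definition slspecd_id (X : slspecd) : slspecd_hom X X :=
  @SLSpecDHom X X id (@strongly_spectral_id X) (@slspecd_id_dist X).

Definition slspecd_comp (X Y Z : slspecd) (g : slspecd_hom Y Z)
    (f : slspecd_hom X Y) : slspecd_hom X Z :=
  @SLSpecDHom X Z (g \o f)
    (strongly_spectral_comp (slspecd_spectral g) (slspecd_spectral f))
    (@slspecd_comp_dist X Y Z g f).

Definition slSpecDs : category.
Proof.
by apply: (@Category slspecd slspecd_hom slspecd_id slspecd_comp) => *; apply: slspecd_hom_eq.
Defined.

(* The zero of [L : bDistrLatticeType d] is the bottom element of its order. *)
Definition prime_filter d (L : bDistrLatticeType d) (F : set L) : Prop :=
  [/\ F !=set0, F <> setT,
      forall a b, F a -> (a <= b)%O -> F b,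
      forall a b, F a -> F b -> F (Order.meet a b) &
      forall a b, F (Order.join a b) -> F a \/ F b].

Definition PF d (L : bDistrLatticeType d) : set (set L) :=
  [set F | prime_filter F].

Definition decent_filters d (L : bDistrLatticeType d) (D : set (set L)) : Prop :=
  forall a b : L, a <> b -> [set F | D F /\ F a] <> [set F | D F /\ F b].

Record zlatd := ZLatDObj {
  zlatd_disp : Order.disp_t;
  zlatd_lat :> bDistrLatticeType zlatd_disp;
  filters : set (set zlatd_lat);
  filters_prime : filters `<=` @PF _ zlatd_lat;
  filters_decent : decent_filters filters }.

Arguments filters : clear implicits.

(* [{lmorphism L -> M}] preserves meets and joins, but not the bottom. *)
Record zlatd_hom (L M : zlatd) := ZLatDHom {
  zlatd_fun :> {lmorphism L -> M};
  zlatd_zero : zlatd_fun Order.bottom = Order.bottom;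
  zlatd_dominating : forall a : M, exists b : L,
    Order.join a (zlatd_fun b) = zlatd_fun b;
  zlatd_filters : forall G : set M, filters M G ->
    filters L [set a | G (zlatd_fun a)] }.

Lemma lmorphism_eq d (L : latticeType d) d' (M : latticeType d')
  (f g : {lmorphism L -> M}) : f =1 g -> f = g.
Proof.
case: f g => [f [[fI] [fU] [fO]]] [g [[gI] [gU] [gO]]] /= /funext fg.
subst g.
by rewrite (Prop_irrelevance fI gI) (Prop_irrelevance fU gU)
  (Prop_irrelevance fO gO).
Qed.

Lemma zlatd_hom_eq (L M : zlatd) (f g : zlatd_hom L M) : f =1 g -> f = g.
Proof.
case: f g => [f f0 fd ff] [g g0 gd gf] /= /lmorphism_eq fg.
by subst g; rewrite (Prop_irrelevance f0 g0) (Prop_irrelevance fd gd)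
  (Prop_irrelevance ff gf).
Qed.

Definition zlatd_id (L : zlatd) : zlatd_hom L L :=
  @ZLatDHom L L idfun erefl (fun a => ex_intro _ a (joinxx a)) (fun G DG => DG).

Definition lmorphism_comp d (L : latticeType d) d' (M : latticeType d')
    d'' (N : latticeType d'') (g : {lmorphism M -> N}) (f : {lmorphism L -> M}) :
    {lmorphism L -> N} :=
  HB.pack (g \o f)
    (Order.isOrderMorphism.Build d L d'' N (g \o f)
       (comp_is_nondecreasing g f))
    (Order.isLatticeMorphism.Build d L d'' N (g \o f)
       (comp_is_meet_morphism g f) (comp_is_join_morphism g f)).

Section ZLatDComp.
Variables (L M N : zlatd) (g : zlatd_hom M N) (f : zlatd_hom L M).

Lemma zlatd_comp_zero : (g \o f) Order.bottom = Order.bottom.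
Proof. by rewrite /= (zlatd_zero f) (zlatd_zero g). Qed.

Lemma zlatd_comp_dominating (a : N) :
  exists b : L, Order.join a ((g \o f) b) = (g \o f) b.
Proof.
have [b ab] := zlatd_dominating g a; have [c bc] := zlatd_dominating f b.
by exists c; rewrite /= -bc omorphU joinA ab.
Qed.

Lemma zlatd_comp_filters (G : set N) :
  filters N G -> filters L [set a | G ((g \o f) a)].
Proof. by move=> /(zlatd_filters g)/(zlatd_filters f). Qed.

Definition zlatd_comp : zlatd_hom L N :=
  @ZLatDHom L N (lmorphism_comp g f) zlatd_comp_zero zlatd_comp_dominating
    zlatd_comp_filters.

End ZLatDComp.

Definition ZLatD : category.
Proof.
by apply: (@Category zlatd zlatd_hom zlatd_id zlatd_comp) => *; apply: zlatd_hom_eq.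
Defined.

(* Main.v *)
From HB Require Import structures.
From mathcomp Require Import all_boot all_order.
From mathcomp Require Import all_classical topology.
Require Import Defs.

Set Implicit Arguments.
Unset Strict Implicit.
Unset Printing Implicit Defensive.

Import Order.Theory.

Local Open Scope classical_set_scope.

(** Each of the two geometric categories is compared with the opposite of the
    category of lattices; the third equivalence follows by composition.

    A T0 locally small space with its smops, and a strongly locally spectral
    space with its compact open sets and decent subset, are both a T0 ring of
    sets, covering its carrier, in which a member is determined by the
    distinguished points that it contains ([pointed_ring]). The ring is a
    distributive lattice with zero, the distinguished points give a decent set
    of prime filters, and taking preimages is contravariant ([dual],
    [dual_map]). The resulting functors are shown to be full, faithful and
    essentially surjective.

    Faithfulness is the T0 axiom ([dual_map_inj]). Fullness amounts to
    recovering a point map from a lattice homomorphism [h], which is possible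
    once the pullback along [h] of the filter of a point is again the filter of
    a point ([dual_map_surj]). For locally small spaces this is part of the
    definition of a morphism of lattices, because all points are distinguished.
    For strongly locally spectral spaces every prime filter of compact open sets
    is the filter of a point, which is where sobriety and compactness enter
    ([prime_filter_point]).

    Essential surjectivity means representing a lattice [L] with filters [D].
    As a locally small space one takes [D] itself, with the sets of filters that
    contain a given element as smops ([filter_space]). As a strongly locally
    spectral space one takes all prime filters, topologised by the analogous
    sets, with [D] distinguished: these sets are compact by an ultrafilter
    argument ([basic_compact]), they are all the compact open sets
    ([CO_basicP]), and they are spectral subspaces ([basic_spectral]). Since [D]
    separates the elements of [L], both representations are faithful without any
    appeal to the prime ideal theorem. *)

(** * Equivalences of categories *)

Definition full (C D : category) (F : functor C D) : Prop :=
  forall (X Y : C) (g : hom (F X) (F Y)), exists f : hom X Y, fmap F f = g.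

Definition faithful (C D : category) (F : functor C D) : Prop :=
  forall (X Y : C) (f f' : hom X Y), fmap F f = fmap F f' -> f = f'.

Definition essentially_surjective (C D : category) (F : functor C D) : Prop :=
  forall Y : D, exists (X : C) (f : hom (F X) Y), iso f.

Lemma iso_comp (C : category) (X Y Z : C) (g : hom Y Z) (f : hom X Y) :
  iso g -> iso f -> iso (compm g f).
Proof.
move=> [g' [g'g gg']] [f' [f'f ff']]; exists (compm f' g'); split.
  by rewrite compmA -(compmA f') g'g compm1.
by rewrite compmA -(compmA g) ff' compm1.
Qed.

Lemma iso_fmap (C D : category) (F : functor C D) (X Y : C) (f : hom X Y) :
  iso f -> iso (fmap F f).
Proof.
by move=> [g [gf fg]]; exists (fmap F g); rewrite -!fmap_comp gf fg !fmap_id.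
Qed.

Lemma iso_reflect (C D : category) (F : functor C D) (X Y : C) (f : hom X Y) :
  full F -> faithful F -> iso (fmap F f) -> iso f.
Proof.
move=> Ffull Ffaith [g [gf fg]]; have [f' f'g] := Ffull _ _ g.
by exists f'; split; apply: Ffaith; rewrite fmap_comp f'g ?gf ?fg fmap_id.
Qed.

Section FullyFaithful.
Variables (C D : category) (F : functor C D).
Hypotheses (Ffull : full F) (Ffaith : faithful F).
Hypothesis Fsurj : essentially_surjective F.

Let lift X Y (g : hom (F X) (F Y)) : hom X Y := sval (cid (Ffull g)).

Let fmap_lift X Y (g : hom (F X) (F Y)) : fmap F (lift g) = g.
Proof. exact: (svalP (cid (Ffull g))). Qed.

Let G0 (Y : D) : C := sval (cid (Fsurj Y)).

Let e_ex (Y : D) : exists f : hom (F (G0 Y)) Y, iso f :=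
  svalP (cid (Fsurj Y)).

Let e (Y : D) : hom (F (G0 Y)) Y := sval (cid (e_ex Y)).

Let e_iso (Y : D) : iso (e Y) := svalP (cid (e_ex Y)).

Let e' (Y : D) : hom Y (F (G0 Y)) := sval (cid (e_iso Y)).

Let e'e Y : compm (e' Y) (e Y) = idm _.
Proof. by have [] := svalP (cid (e_iso Y)). Qed.

Let ee' Y : compm (e Y) (e' Y) = idm _.
Proof. by have [] := svalP (cid (e_iso Y)). Qed.

Let G1 (Y Z : D) (g : hom Y Z) : hom (G0 Y) (G0 Z) :=
  lift (compm (e' Z) (compm g (e Y))).

Let G1_id Y : G1 (idm Y) = idm (G0 Y).
Proof. by apply: Ffaith; rewrite fmap_lift comp1m e'e fmap_id. Qed.

Let G1_comp X Y Z (g : hom Y Z) (f : hom X Y) :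
  G1 (compm g f) = compm (G1 g) (G1 f).
Proof.
apply: Ffaith; rewrite fmap_comp !fmap_lift -!compmA; congr compm.
by rewrite (compmA (e Y)) ee' comp1m.
Qed.

(** The quasi-inverse sends an object to a chosen preimage up to isomorphism,
    and a morphism to the unique one that [F] carries to its conjugate by the
    chosen isomorphisms. *)
Lemma fully_faithful_equivalence : equivalent_categories C D.
Proof.
pose G := @Functor D C G0 G1 G1_id G1_comp.
exists F, G; split.
  exists (fun X => lift (e (F X))); split=> [X Y f|X].
    apply: Ffaith; rewrite !fmap_comp /= !fmap_lift.
    by rewrite compmA ee' comp1m.
  by apply: (iso_reflect Ffull Ffaith); rewrite fmap_lift; apply: e_iso.
exists e; split=> [X Y f|X]; last exact: e_iso.
by rewrite /= fmap_lift compmA ee' comp1m.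
Qed.

End FullyFaithful.

Lemma equivalent_sym (C D : category) :
  equivalent_categories C D -> equivalent_categories D C.
Proof. by move=> [F [G [GF FG]]]; exists G, F. Qed.

(** Shaped for the composite of two equivalences: there [H] is the inner pair of
    functors, known to be naturally the identity. *)
Lemma nat_iso_conjugate (C D : category) (F : functor C D) (G : functor D C)
    (H : functor D D) :
  naturally_isomorphic (comp_functor G F) (id_functor C) ->
  naturally_isomorphic H (id_functor D) ->
  naturally_isomorphic (comp_functor G (comp_functor H F)) (id_functor C).
Proof.
move=> [u [u_nat u_iso]] [v [v_nat v_iso]].
exists (fun X => compm (u X) (fmap G (v (F X)))); split=> [X Y f|X].
  have /= uf := u_nat _ _ f; have /= vf := v_nat _ _ (fmap F f).
  by rewrite /= compmA uf -!compmA -!fmap_comp vf.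
by apply: iso_comp => //; exact: (iso_fmap G (v_iso (F X))).
Qed.

Lemma equivalent_trans (C D E : category) :
  equivalent_categories C D -> equivalent_categories D E ->
  equivalent_categories C E.
Proof.
move=> [F [G [GF FG]]] [F' [G' [GF' FG']]].
exists (comp_functor F' F), (comp_functor G G'); split.
  exact: nat_iso_conjugate GF GF'.
exact: nat_iso_conjugate FG' FG.
Qed.

(** * Rings of sets with distinguished points, and their lattices *)

(** The common shape of the objects of the two geometric categories: the smops
    of a locally small space, all of whose points are distinguished, or the
    compact open sets of a strongly locally spectral space with a decent
    subset. *)
Record pointed_ring := PointedRing {
  pr_car :> Type;
  pr_sets : set (set pr_car);
  pr_points : set pr_car;
  pr_sets0 : pr_sets set0;
  pr_setsI : setI_closed pr_sets;
  pr_setsU : setU_closed pr_sets;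
  pr_cover : forall x, exists2 A, pr_sets A & A x;
  pr_T0 : forall x y, (forall A, pr_sets A -> (A x <-> A y)) -> x = y;
  pr_decent : forall A B, pr_sets A -> pr_sets B ->
    A `&` pr_points = B `&` pr_points -> A = B }.

Arguments pr_sets : clear implicits.
Arguments pr_points : clear implicits.

Record pr_hom (S T : pointed_ring) := PRHom {
  pr_fun :> S -> T;
  pr_bounded : forall A, pr_sets S A ->
    exists2 B, pr_sets T B & A `<=` pr_fun @^-1` B;
  pr_scontinuous : forall B, pr_sets T B -> pr_sets S (pr_fun @^-1` B);
  pr_pointed : forall x, pr_points S x -> pr_points T (pr_fun x) }.

Record member (S : pointed_ring) := Member {
  member_set :> set S;
  memberP : pr_sets S member_set }.

Lemma member_inj (S : pointed_ring) (A B : member S) :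
  member_set A = member_set B -> A = B.
Proof.
case: A B => [A SA] [B SB] /= AB; subst B.
by rewrite (Prop_irrelevance SA SB).
Qed.

HB.instance Definition _ (S : pointed_ring) := gen_eqMixin (member S).
HB.instance Definition _ (S : pointed_ring) := gen_choiceMixin (member S).

Section MemberLattice.
Variable S : pointed_ring.
Implicit Types A B C : member S.

Definition member_meet A B := Member (pr_setsI (memberP A) (memberP B)).
Definition member_join A B := Member (pr_setsU (memberP A) (memberP B)).
Definition member_bottom := Member (pr_sets0 S).

Lemma member_meetC : commutative member_meet.
Proof. by move=> A B; apply: member_inj; apply: setIC. Qed.

Lemma member_joinC : commutative member_join.
Proof. by move=> A B; apply: member_inj; apply: setUC. Qed.

Lemma member_meetA : associative member_meet.
Proof. by move=> A B C; apply: member_inj; apply: setIA. Qed.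

Lemma member_joinA : associative member_join.
Proof. by move=> A B C; apply: member_inj; apply: setUA. Qed.

Lemma member_joinKI B A : member_meet A (member_join A B) = A.
Proof. by apply: member_inj; rewrite /= setIC; apply: setUK. Qed.

Lemma member_meetKU B A : member_join A (member_meet A B) = A.
Proof. by apply: member_inj; rewrite /= setUC; apply: setIK. Qed.

Lemma member_meetUl : left_distributive member_meet member_join.
Proof. by move=> A B C; apply: member_inj; apply: setIUl. Qed.

Lemma member_meetxx : idempotent_op member_meet.
Proof. by move=> A; apply: member_inj; apply: setIid. Qed.

Definition member_le A B := member_meet A B == A.
Definition member_lt A B := (B != A) && member_le A B.

HB.instance Definition _ :=
  Order.isMeetJoinDistrLattice.Build Order.default_display (member S)
    (fun _ _ => erefl) (fun _ _ => erefl)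
    member_meetC member_joinC member_meetA member_joinA
    member_joinKI member_meetKU member_meetUl member_meetxx.

Lemma member_le0x A : (member_bottom <= A)%O.
Proof. by apply/eqP/member_inj; apply: set0I. Qed.

HB.instance Definition _ :=
  Order.hasBottom.Build Order.default_display (member S) member_le0x.

End MemberLattice.

Lemma member_leP (S : pointed_ring) (A B : member S) :
  reflect (A `<=` B) (A <= B)%O.
Proof.
apply: (iffP eqP) => [|AB]; last exact/member_inj/setIidPl.
by move=> /(congr1 (@member_set S)); apply: (iffLR (setIidPl _ _)).
Qed.

Definition member_at (S : pointed_ring) (x : S) : set (member S) :=
  [set A | member_set A x].

Lemma member_at_prime (S : pointed_ring) (x : S) : prime_filter (member_at x).
Proof.
split=> [|/(congr1 (fun F => F Order.bottom))|A B Ax /member_leP|A B Ax Bx|A B].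
- by have [A SA Ax] := pr_cover x; exists (Member SA).
- by rewrite /member_at /= => e; suff: False by []; rewrite e.
- exact.
- by split.
- by [].
Qed.

Definition dual_filters (S : pointed_ring) : set (set (member S)) :=
  [set F | exists2 x, pr_points S x & F = member_at x].

Lemma dual_filters_prime (S : pointed_ring) :
  @dual_filters S `<=` @PF _ (member S).
Proof. by move=> _ [x _ ->]; apply: member_at_prime. Qed.

Lemma dual_filters_decent (S : pointed_ring) : decent_filters (@dual_filters S).
Proof.
move=> A B AB eqAB; apply: AB; apply/member_inj/pr_decent; do ?exact: memberP.
apply/seteqP; split=> x [xAB Sx]; split=> //.
  have : [set F | dual_filters F /\ F A] (member_at x) by split=> //; exists x.
  by rewrite eqAB => -[].
have : [set F | dual_filters F /\ F B] (member_at x) by split=> //; exists x.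
by rewrite -eqAB => -[].
Qed.

Definition dual (S : pointed_ring) : zlatd :=
  ZLatDObj (@dual_filters_prime S) (@dual_filters_decent S).

Section MakeLatticeMorphism.
Variables (d d' : Order.disp_t) (L : latticeType d) (M : latticeType d').
Variable f : L -> M.
Hypothesis fI : {morph f : a b / Order.meet a b >-> Order.meet a b}.
Hypothesis fU : {morph f : a b / Order.join a b >-> Order.join a b}.

(** A lattice morphism carries monotonicity as a separate component, which
    preservation of meets already gives. *)
Lemma meet_morphism_le : {homo f : a b / (a <= b)%O >-> (a <= b)%O}.
Proof. by move=> a b /meet_idPl ab; apply/meet_idPl; rewrite -fI ab. Qed.

#[local] HB.instance Definition _ :=
  Order.isOrderMorphism.Build d L d' M f meet_morphism_le.
#[local] HB.instance Definition _ :=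
  Order.isLatticeMorphism.Build d L d' M f fI fU.

Definition make_lmorphism : {lmorphism L -> M} := f.

End MakeLatticeMorphism.

Section DualMap.
Variables (S T : pointed_ring) (f : pr_hom S T).

Definition member_preimage (B : member T) : member S :=
  Member (pr_scontinuous f (memberP B)).

Lemma member_preimageI :
  {morph member_preimage : A B / Order.meet A B >-> Order.meet A B}.
Proof. by move=> A B; apply: member_inj. Qed.

Lemma member_preimageU :
  {morph member_preimage : A B / Order.join A B >-> Order.join A B}.
Proof. by move=> A B; apply: member_inj. Qed.

Lemma member_preimage0 : member_preimage Order.bottom = Order.bottom.
Proof. by apply: member_inj. Qed.

Lemma member_preimage_dominating (A : member S) :
  exists B : member T, Order.join A (member_preimage B) = member_preimage B.
Proof.
have [B TB AB] := pr_bounded f (memberP A); exists (Member TB).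
by apply/join_idPr/member_leP.
Qed.

Lemma member_preimage_filters (F : set (member S)) : dual_filters F ->
  dual_filters [set B | F (member_preimage B)].
Proof. by move=> [x Sx ->]; exists (f x) => //; apply: pr_pointed. Qed.

Definition dual_map : zlatd_hom (dual T) (dual S) :=
  @ZLatDHom (dual T) (dual S) (make_lmorphism member_preimageI member_preimageU)
    member_preimage0 member_preimage_dominating member_preimage_filters.

End DualMap.

(** Distinct points of a T0 ring of sets are separated by a member, hence a map
    into it is known from the preimages of the members. *)
Lemma dual_map_inj (S T : pointed_ring) (f g : pr_hom S T) :
  dual_map f = dual_map g -> f =1 g.
Proof.
move=> fg x; apply: pr_T0 => A TA.
have /(congr1 (fun B : member S => member_set B x)) /= e :
  dual_map f (Member TA) = dual_map g (Member TA) by rewrite fg.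
by have <- : A (f x) = A (g x) := e.
Qed.

(** Domination keeps the preimage nonempty, preservation of zero keeps it
    proper. *)
Lemma prime_filter_preimage (L M : zlatd) (h : zlatd_hom L M) (G : set M) :
  prime_filter G -> prime_filter [set a | G (h a)].
Proof.
move=> [[a Ga] GT Gle GI GU]; split.
- have [b ab] := zlatd_dominating h a; exists b; apply: Gle Ga _.
  exact/join_idPr.
- move=> e; apply: GT; apply/seteqP; split=> // b _.
  apply: (Gle Order.bottom); last exact: le0x.
  rewrite -(zlatd_zero h).
  by have : [set a | G (h a)] Order.bottom by rewrite e.
- by move=> b c /= Gb bc; apply: Gle Gb _; apply: omorph_le.
- by move=> b c /= Gb Gc; rewrite omorphI; apply: GI.
- by move=> b c /=; rewrite omorphU; apply: GU.
Qed.

(** The map sends a point to one whose filter is the pullback; T0 makes it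
    unique, and the condition on distinguished points relies on that. The two
    geometric categories differ only in how they meet the hypothesis. *)
Lemma dual_map_surj (S T : pointed_ring) (h : zlatd_hom (dual T) (dual S)) :
  (forall x : S, exists y : T, [set B | member_at x (h B)] = member_at y) ->
  exists f : pr_hom S T, dual_map f = h.
Proof.
move=> /choice[f fP].
have hE (B : member T) : f @^-1` B = member_set (h B).
  by apply/seteqP; split=> x; have /(congr1 (fun F => F B)) := fP x;
    rewrite /member_at /= => ->.
have f_bounded A : pr_sets S A -> exists2 B, pr_sets T B & A `<=` f @^-1` B.
  move=> SA.
  have [B /join_idPr/member_leP AB] := zlatd_dominating h (Member SA).
  by exists (member_set B); [apply: memberP|rewrite hE].
have f_scontinuous B : pr_sets T B -> pr_sets S (f @^-1` B).
  by move=> TB; rewrite (hE (Member TB)); apply: memberP.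
have f_pointed x : pr_points S x -> pr_points T (f x).
  move=> Sx; have [|y Ty fy] := @zlatd_filters _ _ h (member_at x).
    by exists x.
  suff -> : f x = y by [].
  apply: pr_T0 => A TA; have : member_at (f x) = member_at y by rewrite -fP.
  by move=> /(congr1 (fun F => F (Member TA))); rewrite /member_at /= => ->.
exists (PRHom f_bounded f_scontinuous f_pointed).
by apply: zlatd_hom_eq => B; apply: member_inj; apply: hE.
Qed.

(** [r] is an isomorphism onto the members of [S], and its inverse transports
    the distinguished filters; domination is trivial for a surjection. *)
Lemma dual_of_representation (L : zlatd) (S : pointed_ring) (r : L -> set S) :
  {morph r : a b / Order.meet a b >-> a `&` b} ->
  {morph r : a b / Order.join a b >-> a `|` b} ->
  r Order.bottom = set0 ->
  injective r ->
  (forall A, pr_sets S A <-> range r A) ->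
  (forall F, filters L F <-> exists2 x, pr_points S x & F = [set a | r a x]) ->
  exists f : @hom (op ZLatD) (dual S) L, iso f.
Proof.
move=> rI rU r0 r_inj rS rF.
have Sr a : pr_sets S (r a) by apply/rS; exists a.
pose f a := Member (Sr a).
have f_surj (A : member S) : exists a, f a = A.
  by have /rS[a _ ra] := memberP A; exists a; apply: member_inj.
have [g fK] := choice f_surj.
have f_inj : injective f by move=> a b /(congr1 (@member_set S)) /r_inj.
have gK a : g (f a) = a by apply: f_inj.
have fI : {morph f : a b / Order.meet a b >-> Order.meet a b}.
  by move=> a b; apply: member_inj; apply: rI.
have fU : {morph f : a b / Order.join a b >-> Order.join a b}.
  by move=> a b; apply: member_inj; apply: rU.
have f0 : f Order.bottom = Order.bottom by apply: member_inj.
have gI : {morph g : A B / Order.meet A B >-> Order.meet A B}.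
  by move=> A B; apply: f_inj; rewrite fI !fK.
have gU : {morph g : A B / Order.join A B >-> Order.join A B}.
  by move=> A B; apply: f_inj; rewrite fU !fK.
have g0 : g Order.bottom = Order.bottom by rewrite -f0 gK.
have fdom A : exists a, Order.join A (f a) = f a.
  by exists (g A); rewrite fK joinxx.
have gdom a : exists A, Order.join a (g A) = g A.
  by exists (f a); rewrite gK joinxx.
have ff F : dual_filters F -> filters L [set a | F (f a)].
  by move=> [x Sx ->]; apply/rF; exists x.
have gf F : filters L F -> dual_filters [set A | F (g A)].
  move=> /rF[x Sx ->]; exists x => //; apply/funext => A.
  by rewrite /member_at /= -[in RHS](fK A).
pose fh := @ZLatDHom L (dual S) (make_lmorphism fI fU) f0 fdom ff.
pose gh := @ZLatDHom (dual S) L (make_lmorphism gI gU) g0 gdom gf.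
by exists fh, gh; split; apply: zlatd_hom_eq => a /=; rewrite ?gK ?fK.
Qed.

(** * Locally small spaces *)

Lemma lss0_cover (X : lss0) (x : X) : exists2 A, smops X A & A x.
Proof. by have : [set: X] x by []; rewrite -(smopsT X) => -[A]; exists A. Qed.

Lemma lss0_decent (X : lss0) (A B : set X) : smops X A -> smops X B ->
  A `&` setT = B `&` setT -> A = B.
Proof. by rewrite !setIT. Qed.

Definition lss0_ring (X : lss0) : pointed_ring :=
  PointedRing (smops0 X) (@smopsI X) (@smopsU X) (@lss0_cover X)
    (@lss0_T0 X) (@lss0_decent X).

Definition lss0_pr_hom (X Y : lss0) (f : lss0_hom X Y) :
    pr_hom (lss0_ring X) (lss0_ring Y) :=
  @PRHom (lss0_ring X) (lss0_ring Y) f (@lss0_bounded _ _ f)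
    (@lss0_scontinuous _ _ f) (fun _ _ => I).

Definition lss0_dual : functor LSSs0 (op ZLatD).
Proof.
apply: (@Functor LSSs0 (op ZLatD) (fun X : lss0 => dual (lss0_ring X))
  (fun X Y f => dual_map (lss0_pr_hom f))).
- by move=> X; apply: zlatd_hom_eq => A; apply: member_inj.
- by move=> X Y Z g f; apply: zlatd_hom_eq => A; apply: member_inj.
Defined.

Lemma lss0_dual_faithful : faithful lss0_dual.
Proof. by move=> X Y f g fg; apply: lss0_hom_eq; apply: dual_map_inj fg. Qed.

(** Every point is distinguished, so a morphism of the dual lattices pulls
    filters of points back to filters of points by definition. *)
Lemma lss0_dual_full : full lss0_dual.
Proof.
move=> X Y h; have [x|f <-] := @dual_map_surj (lss0_ring X) (lss0_ring Y) h.
  have [|y _ hy] := @zlatd_filters _ _ h (member_at (x : lss0_ring X)).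
    by exists x.
  by exists y.
exists (@LSS0Hom X Y f (@pr_bounded _ _ f) (@pr_scontinuous _ _ f)).
by apply: zlatd_hom_eq => A; apply: member_inj.
Qed.

(** * Points given by prime filters *)

Section PrimeFilters.
Variables (d : Order.disp_t) (L : bDistrLatticeType d) (F : set L).
Hypothesis F_prime : prime_filter F.

Lemma prime_filter_meetE a b : F (Order.meet a b) <-> F a /\ F b.
Proof.
have [_ _ Fle FI _] := F_prime; split=> [Fab|[Fa Fb]]; last exact: FI.
by split; apply: Fle Fab _; [apply: leIl|apply: leIr].
Qed.

Lemma prime_filter_joinE a b : F (Order.join a b) <-> F a \/ F b.
Proof.
have [_ _ Fle _ FU] := F_prime; split=> [/FU //|[] Fa]; apply: Fle Fa _.
  exact: leUl.
exact: leUr.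
Qed.

Lemma prime_filter_bottom : ~ F Order.bottom.
Proof.
have [_ FT Fle _ _] := F_prime => F0; apply: FT; apply/seteqP.
by split=> // a _; apply: Fle F0 (le0x a).
Qed.

End PrimeFilters.

Section FilterPoints.
Variables (d : Order.disp_t) (L : bDistrLatticeType d) (D : set (set L)).
Hypothesis D_prime : D `<=` @PF _ L.

Definition filter_point := {F : set L | D F}.

Definition through (a : L) : set filter_point := [set F | sval F a].

Lemma filter_point_prime (F : filter_point) : prime_filter (sval F).
Proof. exact/D_prime/svalP. Qed.

Lemma throughI : {morph through : a b / Order.meet a b >-> a `&` b}.
Proof.
move=> a b; apply/seteqP.
by split=> F /(prime_filter_meetE (filter_point_prime F)).
Qed.

Lemma throughU : {morph through : a b / Order.join a b >-> a `|` b}.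
Proof.
move=> a b; apply/seteqP.
by split=> F /(prime_filter_joinE (filter_point_prime F)).
Qed.

Lemma through0 : through Order.bottom = set0.
Proof.
by apply/seteqP; split=> F // /(prime_filter_bottom (filter_point_prime F)).
Qed.

Lemma through_cover (F : filter_point) : exists a, through a F.
Proof. by have [] := filter_point_prime F. Qed.

Lemma through_separates (F G : filter_point) :
  (forall a, through a F <-> through a G) -> F = G.
Proof.
case: F G => [F DF] [G DG] FG; apply: eq_exist.
by apply/seteqP; split=> a /(FG a).
Qed.

(** With [D] the set of all prime filters and [E] a decent subset, this replaces
    the prime ideal theorem in the representation of [L]. *)
Lemma through_inj (E : set (set L)) :
  E `<=` D -> decent_filters E -> injective through.
Proof.
move=> ED E_decent a b ab; apply: contrapT => /E_decent; apply; apply/seteqP.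
split=> F [EF Fab]; split=> //.
  by have : through a (exist _ F (ED F EF)) := Fab; rewrite ab.
by have : through b (exist _ F (ED F EF)) := Fab; rewrite -ab.
Qed.

Lemma through_set0 : range through set0.
Proof. by exists Order.bottom => //; apply: through0. Qed.

Lemma through_setI : setI_closed (range through).
Proof.
move=> _ _ [a _ <-] [b _ <-].
by exists (Order.meet a b) => //; apply: throughI.
Qed.

Lemma through_setU : setU_closed (range through).
Proof.
move=> _ _ [a _ <-] [b _ <-].
by exists (Order.join a b) => //; apply: throughU.
Qed.

End FilterPoints.

Arguments through {d L} D a _.

Section FilterSpace.
Variable L : zlatd.
Let D := filters L.

Lemma filter_spaceT : \bigcup_(A in range (through D)) A = setT.
Proof.
apply/seteqP; split=> // F _.
by have [a Fa] := through_cover (@filters_prime L) F; exists (through D a).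
Qed.

Lemma filter_space_T0 (F G : filter_point D) :
  (forall A, range (through D) A -> (A F <-> A G)) -> F = G.
Proof.
by move=> FG; apply: through_separates => a; apply: FG; exists a.
Qed.

Definition filter_space : lss0 :=
  LSS0 (through_set0 (@filters_prime L)) (through_setI (@filters_prime L))
    (through_setU (@filters_prime L)) filter_spaceT filter_space_T0.

End FilterSpace.

Lemma lss0_dual_surj : essentially_surjective lss0_dual.
Proof.
move=> L; exists (filter_space L).
have LP := @filters_prime L.
apply: (@dual_of_representation L (lss0_ring (filter_space L))
  (through (filters L))) => //.
- exact: throughI.
- exact: throughU.
- exact: through0.
- exact: through_inj (@filters_decent L).
- move=> F; split=> [LF|[[G LG] _ ->] //].
  by exists (exist _ F LF).
Qed.

(** * Compact open subsets *)

(** Otherwise the sets [K `\` O], for [O] in the cover, generate a proper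
    filter; a cluster point of it in [K] lies in some [O], which misses [K `\` O]. *)
Lemma compact_directed_cover (X : topologicalType) (K : set X)
    (J : set (set X)) :
  compact K -> J set0 -> setU_closed J -> J `<=` open ->
  (forall x, K x -> exists2 O, J O & O x) -> exists2 O, J O & K `<=` O.
Proof.
move=> K_compact J0 JU J_open K_cover; apply: contrapT => noO.
pose F := filter_from J (fun O => K `\` O).
have F_filter : ProperFilter F.
  apply: filter_from_proper; first apply: filter_from_filter.
  - by exists set0.
  - move=> O O' JO JO'; exists (O `|` O'); first exact: JU.
    by move=> x [Kx nOO']; split; split=> // Ox; apply: nOO'; [left|right].
  move=> O JO; apply/set0P/eqP => /subsets_disjoint; rewrite ?setCK => KO.
  by apply: noO; exists O.
have FK : F K by exists set0 => // x [].
have [x [Kx Fx]] := K_compact F F_filter FK.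
have [O JO Ox] := K_cover x Kx.
have FO : F (K `\` O) by exists O.
have nO : nbhs x O by apply: open_nbhs_nbhs; split=> //; apply: J_open.
by have [y [[_ nOy] Oy]] := Fx _ _ FO nO.
Qed.

Lemma CO_set0 (X : topologicalType) : CO (set0 : set X).
Proof. by split; [apply: compact0|apply: open0]. Qed.

Lemma CO_setU (X : topologicalType) : setU_closed (@CO X).
Proof.
by move=> A B [Ac Ao] [Bc Bo]; split; [apply: compactU|apply: openU].
Qed.

Section OpenSubspace.
Variables (X : topologicalType) (U : set X).
Let i : set_type U -> X := set_val.

Lemma val_inU (x : set_type U) : U (i x).
Proof. by have := valP x; rewrite in_setE. Qed.

Lemma val_onto (x : X) : U x -> exists y : set_type U, i y = x.
Proof. by move=> Ux; exists (exist _ x (mem_set Ux)). Qed.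

Lemma preimage_image_val (K : set (set_type U)) : i @^-1` (i @` K) = K.
Proof.
apply/seteqP; split=> [x [y Ky /val_inj <-] //|x Kx]; by exists x.
Qed.

Lemma open_preimage_val (O : set X) :
  open O -> open (i @^-1` O : set (set_type U)).
Proof. by move=> O_open; exists O. Qed.

(** Push a filter on the subspace forward to [X]: its cluster point in [A] comes
    from the subspace, where it is a cluster point of the original filter. *)
Lemma CO_preimage_val (A : set X) :
  A `<=` U -> CO A -> CO (i @^-1` A : set (set_type U)).
Proof.
move=> AU [A_compact A_open]; split; last exact: open_preimage_val.
move=> F F_filter FA.
have [p [Ap Fp]] := A_compact (i @ F) _ FA.
have [q qp] := val_onto (AU p Ap); exists q; split; first by rewrite /= qp.
move=> B V FB; rewrite nbhsE => -[W [[O O_open <-] Oq] OV].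
have Op : nbhs p O by apply: open_nbhs_nbhs; rewrite -qp.
have FiB : F (i @^-1` (i @` B)) by rewrite preimage_image_val.
have [_ [[y By <-] Oy]] := Fp _ _ FiB Op.
by exists y; split=> //; apply: OV.
Qed.

Hypothesis U_open : open U.

Lemma open_image_val (V : set (set_type U)) : open V -> open (i @` V).
Proof.
move=> [O O_open <-]; suff -> : i @` (i @^-1` O) = O `&` U by apply: openI.
apply/seteqP; split=> [_ [y Oy <-]|x [Ox Ux]].
  by split=> //; apply: val_inU.
by have [y yx] := val_onto Ux; exists y => //; rewrite /= yx.
Qed.

Lemma CO_image_val (K : set (set_type U)) : CO K -> CO (i @` K).
Proof.
move=> [K_compact K_open]; split; last exact: open_image_val.
apply: continuous_compact => //; apply: continuous_subspaceT.
exact: initial_continuous.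
Qed.

(** Generic points in the sobriety axiom of a subspace are thus described by the
    open sets of the ambient space. *)
Lemma closure_point_val (x y : set_type U) :
  closure [set x] y <-> forall O, open O -> O (i y) -> O (i x).
Proof.
split=> [xy O O_open Oy|xy B].
  have [|_ [-> //]] := xy (i @^-1` O).
  by apply: open_nbhs_nbhs; split=> //; apply: open_preimage_val.
rewrite nbhsE => -[W [[O O_open <-] Oy] OB].
by exists x; split=> //; apply: OB; apply: xy.
Qed.

End OpenSubspace.

(** * Strongly locally spectral spaces *)

Section StronglyLocallySpectral.
Variable X : topologicalType.
Hypothesis X_sls : strongly_locally_spectral X.

Lemma sls_patch (x : X) :
  exists U : set X, [/\ open U, spectral (set_type U), CO U & U x].
Proof.
have [XT _] := X_sls; have : [set: X] x by [].
rewrite -XT => -[U [U_open U_spec] Ux]; exists U; split=> //.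
have [_ _ U_CO _ _] := U_spec.
suff -> : U = set_val @` [set: set_type U] by apply: CO_image_val.
apply/seteqP; split=> [y Uy|_ [y _ <-]]; last exact: val_inU.
by have [z <-] := val_onto Uy; exists z.
Qed.

(** The compact open sets of a spectral patch stay compact open in the whole
    space, because the patch is open. *)
Lemma sls_basis (O : set X) (x : X) : open O -> O x ->
  exists A : set X, [/\ CO A, A x & A `<=` O].
Proof.
move=> O_open Ox; have [U [U_open [_ _ _ [_ U_basis] _] _ Ux]] := sls_patch x.
have [y yx] := val_onto Ux; subst x.
have [|K [K_CO Ky] KO] := U_basis y (set_val @^-1` O).
  by apply: open_nbhs_nbhs; split=> //; apply: open_preimage_val.
exists (set_val @` K); split; [exact: CO_image_val|by exists y|].
by move=> _ [z Kz <-]; apply: KO.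
Qed.

(** A patch around [x] is itself compact open, so it also contains [y], and its
    own T0 axiom decides. *)
Lemma sls_T0 (x y : X) : (forall A, CO A -> (A x <-> A y)) -> x = y.
Proof.
move=> xy; have [U [U_open [U_T0 _ _ _ _] U_CO Ux]] := sls_patch x.
have Uy : U y by apply/(xy _ U_CO).
have [x' x'x] := val_onto Ux; have [y' y'y] := val_onto Uy.
rewrite -x'x -y'y; congr set_val; apply/eqP; apply: contrapT => /negP xy'.
have sep (u v : set_type U) (A : set (set_type U)) :
    A \in nbhs u -> v \in ~` A ->
    (forall B, CO B -> B (set_val u) -> B (set_val v)) -> False.
  rewrite !in_setE nbhsE => -[W [[O O_open <-] Ou] OA] nAv uv.
  have [B [B_CO Bu BO]] := sls_basis O_open Ou.
  by apply: nAv; apply: OA; apply: BO; apply: uv.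
have [A [[Ax Ay]|[Ay Ax]]] := U_T0 x' y' xy'.
  by apply: sep Ax Ay _ => B /(xy B)[]; rewrite x'x y'y.
by apply: sep Ay Ax _ => B /(xy B)[]; rewrite x'x y'y.
Qed.

End StronglyLocallySpectral.

Section SlspecdRing.
Variable X : slspecd.

Lemma slspecd_cover (x : X) : exists2 A, CO A & A x.
Proof.
by have [U [_ _ U_CO Ux]] := sls_patch (slspecd_sls X) x; exists U.
Qed.

Lemma slspecd_separated (A B : set X) : CO A -> CO B ->
  A `&` distinguished X = B `&` distinguished X -> A = B.
Proof.
move=> A_CO B_CO AB; apply: contrapT => nAB.
exact: (@slspecd_decent X _ _ A_CO B_CO nAB).
Qed.

Definition slspecd_ring : pointed_ring :=
  PointedRing (@CO_set0 X) (proj2 (slspecd_sls X)) (@CO_setU X) slspecd_cover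
    (sls_T0 (slspecd_sls X)) slspecd_separated.

(** For a prime filter [F] of compact open sets let [W] be the union
    of those outside [F]. By compactness and primeness a compact open set is
    covered by [W] only if it lies outside [F]; so [W] misses a point of some
    spectral patch [U], [U] belongs to [F], and the trace of [W] on [U] is
    meet-irreducible because [F] is closed under meets. The generic point of
    its complement generates [F]. *)
Lemma prime_filter_point (F : set (member slspecd_ring)) :
  prime_filter F -> exists x : X, F = member_at (x : slspecd_ring).
Proof.
move=> F_prime; have [[A0 FA0] _ Fle FI FU] := F_prime.
pose J : set (set X) :=
  [set A | exists2 B : member slspecd_ring, ~ F B & member_set B = A].
pose W : set X := \bigcup_(A in J) A.
have J_open : J `<=` open by move=> _ [B _ <-]; have [] := memberP B.
have W_open : open W by apply: bigcup_open => A /J_open.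
have J0 : J set0.
  by exists Order.bottom => //; apply: prime_filter_bottom F_prime.
have JU : setU_closed J.
  move=> _ _ [A nFA <-] [B nFB <-]; exists (Order.join A B) => //.
  by move=> /FU [].
have notW (A : member slspecd_ring) : F A -> exists2 x, member_set A x & ~ W x.
  move=> FA; apply: contrapT => noX.
  have [A_compact _] := memberP A.
  have [x Ax|_ [B nFB <-] AB] := compact_directed_cover A_compact J0 JU J_open.
    apply: contrapT => nJx; apply: noX.
    by exists x => // -[O JO Ox]; apply: nJx; exists O.
  by apply: nFB; apply: Fle FA _; apply/member_leP.
have inF (A : member slspecd_ring) x : member_set A x -> ~ W x -> F A.
  move=> Ax nWx; apply: contrapT => nFA; apply: nWx.
  by exists (member_set A) => //; exists A.
have [x0 _ nWx0] := notW A0 FA0.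
have [U [U_open [_ U_sober _ _ _] U_CO Ux0]] := sls_patch (slspecd_sls X) x0.
pose mU : member slspecd_ring := @Member slspecd_ring U U_CO.
have FmU : F mU by apply: (@inF mU x0).
pose V : set (set_type U) := set_val @^-1` W.
have V_open : open V by apply: open_preimage_val.
have VT : V <> setT.
  have [y yx0] := val_onto Ux0; move=> /(congr1 (fun S => S y)) /= e.
  by apply: nWx0; rewrite -yx0 -[W _]/(V y) [V y]e.
(* An open set that is not inside [W] on [U] contains a member of [F]. *)
have grow (O : set X) :
    open O -> V `<=` set_val @^-1` O -> V <> set_val @^-1` O ->
    exists2 A : member slspecd_ring, F A & member_set A `<=` O.
  move=> O_open VO nVO.
  have [y Oy nVy] : exists2 y : set_type U, O (set_val y) & ~ V y.
    apply: contrapT => noy; apply: nVO; apply/seteqP; split=> // y Oy.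
    by apply: contrapT => nVy; apply: noy; exists y.
  have [A [A_CO Ay AO]] := sls_basis (slspecd_sls X) O_open Oy.
  by exists (@Member slspecd_ring A A_CO) => //; exact: (@inF _ (set_val y)).
have [[V1 [V2 [[O1 O1_open <-] [O2 O2_open <-] VE nV1 nV2]]]|[x VE]] :=
  U_sober V V_open VT.
  have [||A1 FA1 AO1] := grow O1 O1_open; [by rewrite VE => y []|by []|].
  have [||A2 FA2 AO2] := grow O2 O2_open; [by rewrite VE => y []|by []|].
  have FA := FI _ _ (FI _ _ FA1 FA2) FmU.
  have [y [[A1y A2y] Uy] nWy] := notW _ FA; have [z zy] := val_onto Uy.
  case: nWy; rewrite -zy; suff : V z by [].
  by rewrite VE; split; rewrite /= zy; [apply: AO1|apply: AO2].
exists (set_val x); apply/seteqP; split=> A.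
  move=> FA; have [y [Ay Uy] nWy] := notW _ (FI _ _ FA FmU).
  have [z zy] := val_onto Uy; have [_ A_open] := memberP A.
  have : closure [set x] z.
    apply: contrapT => nxz; apply: nWy; rewrite -zy.
    by suff : V z by []; rewrite VE.
  by move=> /closure_point_val; apply=> //; rewrite zy.
move=> Ax; apply: inF Ax _ => Wx; have : V x by [].
by rewrite VE; apply; apply/closure_point_val.
Qed.

End SlspecdRing.

Section SlspecdDual.
Variables (X Y : slspecd) (f : slspecd_hom X Y).

Lemma slspecd_bounded (A : set X) : CO A -> exists2 B, CO B & A `<=` f @^-1` B.
Proof.
move=> A_CO; have [B B_CO AB] := (slspecd_spectral f).1 A A_CO.
by exists B => // x Ax; apply: AB; exists x.
Qed.

Lemma slspecd_pointed (x : X) : distinguished X x -> distinguished Y (f x).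
Proof. by move=> Xx; apply: (@slspecd_dist _ _ f); exists x. Qed.

Definition slspecd_pr_hom : pr_hom (slspecd_ring X) (slspecd_ring Y) :=
  @PRHom (slspecd_ring X) (slspecd_ring Y) f slspecd_bounded
    (slspecd_spectral f).2 slspecd_pointed.

End SlspecdDual.

Definition slspecd_dual : functor slSpecDs (op ZLatD).
Proof.
apply: (@Functor slSpecDs (op ZLatD) (fun X : slspecd => dual (slspecd_ring X))
  (fun X Y f => dual_map (slspecd_pr_hom f))).
- by move=> X; apply: zlatd_hom_eq => A; apply: member_inj.
- by move=> X Y Z g f; apply: zlatd_hom_eq => A; apply: member_inj.
Defined.

Lemma slspecd_dual_faithful : faithful slspecd_dual.
Proof.
by move=> X Y f g fg; apply: slspecd_hom_eq; apply: dual_map_inj fg.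
Qed.

(** Every prime filter of compact open sets is the filter of a point, so any
    lattice morphism between duals is a preimage map. *)
Lemma slspecd_dual_full : full slspecd_dual.
Proof.
move=> X Y h.
have [x|f <-] := @dual_map_surj (slspecd_ring X) (slspecd_ring Y) h.
  apply: prime_filter_point.
  have x_prime := member_at_prime (x : slspecd_ring X).
  exact: (@prime_filter_preimage _ _ h _ x_prime).
have f_spectral : strongly_spectral (f : X -> Y).
  split=> [A /(pr_bounded f)[B B_CO AB]|]; last exact: (pr_scontinuous f).
  by exists B => // _ [x Ax <-]; apply: AB.
have f_dist : (f : X -> Y) @` distinguished X `<=` distinguished Y.
  by move=> _ [x Xx <-]; apply: (pr_pointed f).
exists (SLSpecDHom f_spectral f_dist).
by apply: zlatd_hom_eq => A; apply: member_inj.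
Qed.

(** * The spectrum *)

Section Spectrum.
Variables (d : Order.disp_t) (L : bDistrLatticeType d).

Definition spectrum := filter_point (@PF _ L).

Definition basic (a : L) : set spectrum := through (@PF _ L) a.

Let LP : @PF _ L `<=` @PF _ L := @subset_refl _ _.

Lemma basicI (a b : L) : basic (Order.meet a b) = basic a `&` basic b.
Proof. exact: throughI. Qed.

Lemma basicU (a b : L) : basic (Order.join a b) = basic a `|` basic b.
Proof. exact: throughU. Qed.

Lemma basic0 : basic Order.bottom = set0.
Proof. exact: through0. Qed.

Definition spectrum_open (O : set spectrum) : Prop :=
  forall F, O F -> exists2 a, basic a F & basic a `<=` O.

Lemma spectrum_openT : spectrum_open setT.
Proof. by move=> F _; have [a Fa] := through_cover LP F; exists a. Qed.

Lemma spectrum_openI : setI_closed spectrum_open.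
Proof.
move=> O O' O_open O'_open F [/O_open[a aF aO] /O'_open[b bF bO]].
exists (Order.meet a b); rewrite basicI; first by split.
exact: setISS.
Qed.

Lemma spectrum_open_bigU (I : Type) (f : I -> set spectrum) :
  (forall i, spectrum_open (f i)) -> spectrum_open (\bigcup_i f i).
Proof.
move=> f_open F [i _ /f_open[a aF af]].
by exists a => // G /af fG; exists i.
Qed.

HB.instance Definition _ := gen_eqMixin spectrum.
HB.instance Definition _ := gen_choiceMixin spectrum.
HB.instance Definition _ := isOpenTopological.Build spectrum
  spectrum_openT spectrum_openI spectrum_open_bigU.

Lemma open_basicP (O : set spectrum) (F : spectrum) : open O -> O F ->
  exists2 a, basic a F & basic a `<=` O.
Proof. by move=> O_open; apply: O_open. Qed.

Lemma basic_open (a : L) : open (basic a).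
Proof. by move=> F aF; exists a. Qed.

(** An ultrafilter on the spectrum converges to the prime filter of the
    elements whose basic open set it contains; primeness of the limit is the
    fact that an ultrafilter chooses a side of every union. *)
Lemma basic_compact (a : L) : compact (basic a).
Proof.
rewrite compact_ultra => U U_ultra Ua.
pose F : set L := [set b | U (basic b)].
have F_prime : prime_filter F.
  split.
  - by exists a.
  - move=> /(congr1 (fun S => S Order.bottom)); rewrite /F /= basic0 => U0.
    by apply: (@filter_not_empty _ U); rewrite U0.
  - move=> b c Ub /join_idPr bc; apply: filterS Ub.
    by rewrite -bc basicU; left.
  - by move=> b c Ub Uc; rewrite /F /= basicI; apply: filterI.
  - move=> b c; rewrite /F /= basicU => Ubc.
    have [|Unb] := in_ultra_setVsetC (basic b) U_ultra; first by left.
    by right; apply: filterS (filterI Ubc Unb) => G [[]].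
exists (exist _ F F_prime : spectrum); split=> // V.
rewrite nbhsE => -[O [O_open OF] OV].
by have [b bF bO] := open_basicP O_open OF; apply: filterS bF => G /bO /OV.
Qed.

(** The basic open sets inside [K] form a directed cover, so that a compact open
    [K] is one of them. *)
Lemma CO_basicP (K : set spectrum) : CO K <-> range basic K.
Proof.
split=> [[K_compact K_open]|[a _ <-]]; last first.
  by split; [apply: basic_compact|apply: basic_open].
pose J : set (set spectrum) := [set A | range basic A /\ A `<=` K].
have [||A [[a _ <-] _]|F KF|_ [[a _ <-] aK] Ka] :=
  compact_directed_cover K_compact (J := J).
- by split=> //; exists Order.bottom => //; apply: basic0.
- move=> _ _ [[a _ <-] aK] [[b _ <-] bK]; split; last by rewrite subUset.
  by exists (Order.join a b) => //; apply: basicU.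
- exact: basic_open.
- by have [a aF aK] := open_basicP K_open KF; exists (basic a).
- by exists a => //; apply/seteqP.
Qed.

Lemma spectrum_CO_setI : setI_closed (@CO spectrum).
Proof.
move=> _ _ /CO_basicP[a _ <-] /CO_basicP[b _ <-]; rewrite -basicI.
by apply/CO_basicP; exists (Order.meet a b).
Qed.

(** The generic point of a meet-irreducible open subset [W] of a patch is the
    filter of the elements whose basic open set, cut down to the patch, is not
    inside [W]. *)
Lemma basic_sober (a : L) : sober (set_type (basic a)).
Proof.
move=> W [O O_open <-] WT.
have [|W_irreducible] := pselect (exists V1 V2 : set (set_type (basic a)),
  [/\ open V1, open V2, set_val @^-1` O = V1 `&` V2,
     set_val @^-1` O <> V1 & set_val @^-1` O <> V2]); first by left.
right; pose F : set L := [set b | ~ (basic b `&` basic a `<=` O)].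
have notF b : ~ F b -> basic b `&` basic a `<=` O by apply: contrapT.
have F_prime : prime_filter F.
  split.
  - exists a; rewrite /F /= setIid => aO; apply: WT; apply/seteqP.
    by split=> // x _; apply: (aO _ (val_inU x)).
  - move=> /(congr1 (fun S => S Order.bottom)) FT.
    have : F Order.bottom by rewrite FT.
    by apply; rewrite basic0 set0I; apply: sub0set.
  - move=> b c Fb /join_idPr bc cO; apply: Fb; apply: subset_trans cO.
    by apply: setSI; rewrite -bc basicU.
  - move=> b c Fb Fc; rewrite /F /= basicI => bcO; apply: W_irreducible.
    (* By distributivity, adding [basic b] and [basic c] to [O] splits it. *)
    exists (set_val @^-1` (O `|` basic b)), (set_val @^-1` (O `|` basic c)).
    have grow e : F e -> set_val @^-1` O <>
        (set_val @^-1` (O `|` basic e) : set (set_type (basic a))).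
      move=> Fe Oe; apply: Fe => G [eG /val_onto[y yG]].
      have : (set_val @^-1` (O `|` basic e)) y by right; rewrite yG.
      by rewrite -Oe /= yG.
    split; do ?[by apply: grow | by apply/open_preimage_val/openU/basic_open].
    apply/seteqP; split=> [y Oy|y [[//|yb] [//|yc]]]; first by split; left.
    by apply: bcO; split=> //; apply: val_inU.
  - move=> b c; rewrite /F /= basicU => Fbc.
    apply: contrapT => /not_orP[/notF bO /notF cO]; apply: Fbc.
    by rewrite setIUl subUset.
have Fa : F a.
  have [[b Fb] _ _ _ _] := F_prime => aO.
  by apply: Fb => G [_ aG]; apply: aO.
have [x xF] := @val_onto _ (basic a) (exist _ F F_prime : spectrum) Fa.
exists x; apply/seteqP; split=> y.
  move=> Oy /closure_point_val /(_ O O_open Oy); rewrite xF => OF.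
  by have [b bF bO] := open_basicP O_open OF; apply: bF => G [/bO].
move=> nxy; apply: contrapT => nOy; apply: nxy; apply/closure_point_val.
move=> O' O'_open O'y; have [b yb bO'] := open_basicP O'_open O'y.
rewrite xF; apply: bO' => bO; apply: nOy; apply: bO; split=> //.
exact: val_inU.
Qed.

Lemma basic_spectral (a : L) : spectral (set_type (basic a)).
Proof.
have a_open := basic_open (a := a).
have i_inj : injective (set_val : set_type (basic a) -> spectrum).
  exact: val_inj.
have a_CO : CO (basic a) by apply/CO_basicP; exists a.
split.
- move=> x y xy.
  have [b] : exists b, ~ (basic b (set_val x) <-> basic b (set_val y)).
    apply: contrapT => nob; move/eqP: xy; apply; apply: i_inj.
    apply: through_separates => b; apply: contrapT => nb.
    by apply: nob; exists b.
  have nb (z : set_type (basic a)) c : basic c (set_val z) ->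
      (set_val @^-1` basic c : set (set_type (basic a))) \in nbhs z.
    move=> cz; rewrite in_setE; apply: open_nbhs_nbhs; split=> //.
    exact/open_preimage_val/basic_open.
  move=> nbxy; exists (set_val @^-1` basic b).
  have [bx|nbx] := pselect (basic b (set_val x)); [left|right].
    split; [exact: nb|rewrite in_setE => by_; exact: nbxy].
  split; last by rewrite in_setE.
  by apply: nb; apply: contrapT => nby; apply: nbxy.
- exact: basic_sober.
- suff -> : [set: set_type (basic a)] = set_val @^-1` basic a.
    exact: CO_preimage_val.
  by apply/seteqP; split=> // x _; apply: val_inU.
- split=> [A [] //|x V]; rewrite nbhsE => -[_ [[O O_open <-] Ox] OV].
  have [b bx bO] := open_basicP O_open Ox.
  exists (set_val @^-1` basic (Order.meet b a)).
    split; last by rewrite /= basicI; split=> //; apply: val_inU.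
    apply: CO_preimage_val; first by rewrite basicI => ? [].
    by apply/CO_basicP; exists (Order.meet b a).
  by move=> y; rewrite /= basicI => -[/bO /OV].
- move=> A B A_CO B_CO.
  suff -> : A `&` B = set_val @^-1` ((set_val @` A) `&` (set_val @` B)).
    apply: CO_preimage_val; first by move=> _ [[x _ <-] _]; apply: val_inU.
    by apply: spectrum_CO_setI; apply: CO_image_val.
  by rewrite preimage_setI !preimage_image_val.
Qed.

Lemma spectrum_sls : strongly_locally_spectral spectrum.
Proof.
split; last exact: spectrum_CO_setI.
apply/seteqP; split=> // F _; have [a aF] := through_cover LP F.
by exists (basic a) => //; split; [apply: basic_open|apply: basic_spectral].
Qed.

End Spectrum.

Section SpectrumDual.
Variable L : zlatd.

Definition spectrum_points : set (spectrum L) := [set F | filters L (sval F)].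

Lemma basic_inj : injective (@basic _ L).
Proof. exact: through_inj (@filters_prime L) (@filters_decent L). Qed.

Lemma spectrum_decent : decent_subset spectrum_points.
Proof.
move=> _ _ /CO_basicP[a _ <-] /CO_basicP[b _ <-] nab ab.
have /(@filters_decent L) : a <> b by move=> e; apply: nab; rewrite e.
apply; apply/seteqP; split=> F [LF Fab]; split=> //.
  have : (basic a `&` spectrum_points) (exist _ F (filters_prime LF)) by [].
  by rewrite ab => -[].
have : (basic b `&` spectrum_points) (exist _ F (filters_prime LF)) by [].
by rewrite -ab => -[].
Qed.

Definition spectrum_slspecd : slspecd :=
  SLSpecD (@spectrum_sls _ L) spectrum_decent.

End SpectrumDual.

Lemma slspecd_dual_surj : essentially_surjective slspecd_dual.
Proof.
move=> L; exists (spectrum_slspecd L).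
apply: (@dual_of_representation L (slspecd_ring (spectrum_slspecd L))
  (@basic _ L)).
- exact: basicI.
- exact: basicU.
- exact: basic0.
- exact: basic_inj.
- exact: CO_basicP.
- move=> F; split=> [LF|[[G PG] LG ->] //].
  by exists (exist _ F (filters_prime LF)).
Qed.

Theorem theorem9p5 :
  equivalent_categories LSSs0 (op ZLatD) /\
  equivalent_categories (op ZLatD) slSpecDs /\
  equivalent_categories LSSs0 slSpecDs.
Proof.
have lss0_eq : equivalent_categories LSSs0 (op ZLatD) :=
  fully_faithful_equivalence lss0_dual_full lss0_dual_faithful lss0_dual_surj.
have slspecd_eq : equivalent_categories (op ZLatD) slSpecDs :=
  equivalent_sym (fully_faithful_equivalence slspecd_dual_full
    slspecd_dual_faithful slspecd_dual_surj).
by do 2?split=> //; apply: equivalent_trans lss0_eq slspecd_eq.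
Qed.
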